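(* Let $(M,g)$ be any semi-Riemannian manifold of dimension $n\ge 3$, with Riemann curvature tensor $R$, concircular curvature tensor $W$, projective curvature tensor $P$, conformal curvature tensor $C$ and conharmonic curvature tensor $K$. Then for each of the pairs $(D_1,D_2)=(R,W),\ (W,R),\ (P,R),\ (C,K),\ (K,C)$ the identity $$(D_1\cdot D_2)(X_1,X_2,X_3,X_4,X_5,X_6)+(D_1\cdot D_2)(X_3,X_4,X_5,X_6,X_1,X_2)+(D_1\cdot D_2)(X_5,X_6,X_1,X_2,X_3,X_4)=0$$ holds for all vector fields $X_1,\dots,X_6$ on $M$.
   Context: $(M,g)$ is a connected smooth semi-Riemannian manifold of dimension $n\ge 3$; $R$ is the $(0,4)$ Riemann curvature tensor, with the sign convention that the Ricci tensor $S(X_2,X_3)$ is the $g$-trace of $R(X_1,X_2,X_3,X_4)$ over $X_1,X_4$; $\kappa$ is the scalar curvature. The Kulkarni–Nomizu product of $(0,2)$-tensors is $(A\wedge E)(X_1,X_2,X_3,X_4)=A(X_1,X_4)E(X_2,X_3)+A(X_2,X_3)E(X_1,X_4)-A(X_1,X_3)E(X_2,X_4)-A(X_2,X_4)E(X_1,X_3)$. Then $C=R-\frac{1}{n-2}g\wedge S+\frac{\kappa}{2(n-1)(n-2)}g\wedge g$, $W=R-\frac{\kappa}{2n(n-1)}g\wedge g$, $K=R-\frac{1}{n-2}g\wedge S$, and $P(X_1,X_2,X_3,X_4)=R(X_1,X_2,X_3,X_4)-\frac{1}{n-1}\left[S(X_2,X_3)g(X_1,X_4)-S(X_1,X_3)g(X_2,X_4)\right]$.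 For a $(0,4)$-tensor $D$, let $\mathcal D$ be the $(1,3)$-tensor with $g(\mathcal D(X,Y)X_1,X_2)=D(X,Y,X_1,X_2)$. For a $(0,k)$-tensor $H$, the $(0,k+2)$-tensor $D\cdot H$ is $$(D\cdot H)(X_1,\dots,X_k,X,Y)=-H(\mathcal D(X,Y)X_1,X_2,\dots,X_k)-\cdots-H(X_1,\dots,X_{k-1},\mathcal D(X,Y)X_k).$$ *)

(* Defs.v *)
From HB Require Import structures.
From mathcomp Require Import all_boot all_order all_algebra.
From mathcomp Require Import all_classical all_reals all_analysis.

Set Implicit Arguments.
Unset Strict Implicit.
Unset Printing Implicit Defensive.
Import Order.TTheory GRing.Theory Num.Theory numFieldNormedType.Exports.
Local Open Scope classical_set_scope.
Local Open Scope ring_scope.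

(* All partial derivatives of order at most k exist and are continuous on U
   (meant for U open, the value of f outside U being irrelevant). *)
Fixpoint Ck_on (R : realType) (n k : nat) (U : set 'rV[R]_n)
    (f : 'rV[R]_n -> R) : Prop :=
  (forall x, U x -> {for x, continuous f}) /\
  (if k is k'.+1 then
     forall i : 'I_n, (forall x, U x -> derivable f x (delta_mx 0 i)) /\
                      Ck_on k' U (fun x => 'D_(delta_mx 0 i) f x)
   else True).

Definition smooth_on (R : realType) (n : nat) (U : set 'rV[R]_n)
    (f : 'rV[R]_n -> R) : Prop := forall k, Ck_on k U f.

(* A homeomorphism from an open set of M onto an open set of R^n; the values of
   cmap outside cdom and of cinv outside ccod are irrelevant. *)
Record chart (R : realType) (n : nat) (M : topologicalType) := Chart {
  cdom : set M;
  ccod : set 'rV[R]_n;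
  cmap : M -> 'rV[R]_n;
  cinv : 'rV[R]_n -> M;
  cdom_open : open cdom;
  ccod_open : open ccod;
  cmap_cod : forall p, cdom p -> ccod (cmap p);
  cinv_dom : forall x, ccod x -> cdom (cinv x);
  cmapK : forall p, cdom p -> cinv (cmap p) = p;
  cinvK : forall x, ccod x -> cmap (cinv x) = x;
  cmap_continuous : forall p, cdom p -> {for p, continuous cmap};
  cinv_continuous : forall x, ccod x -> {for x, continuous cinv} }.

Record smoothManifold (R : realType) (n : nat) := SmoothManifold {
  carrier :> topologicalType;
  manifold_hausdorff : hausdorff_space carrier;
  manifold_second_countable : @second_countable carrier;
  atlas : set (chart R n carrier);
  atlas_cover : forall p : carrier, exists2 c, atlas c & cdom c p;
  atlas_compatible : forall c c', atlas c -> atlas c' -> forall j : 'I_n,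
    smooth_on (ccod c `&` cinv c @^-1` cdom c')
      (fun x => cmap c' (cinv c x) 0 j) }.

Definition smooth (R : realType) (n : nat) (M : smoothManifold R n)
    (f : M -> R) : Prop :=
  forall c, atlas c -> smooth_on (ccod c) (f \o cinv c).

Section SmoothOn.
Context (R : realType) (n : nat).
Implicit Types (U : set 'rV[R]_n) (f g : 'rV[R]_n -> R).

Lemma near_eq_on (T : topologicalType) (U : set T) (f g : T -> R) x :
  open U -> (forall y, U y -> f y = g y) -> U x -> \forall y \near x, f y = g y.
Proof.
by move=> oU fg Ux; apply: filterS (open_nbhs_nbhs (conj oU Ux)) => y /fg.
Qed.

Lemma eq_continuous_on (T : topologicalType) (U : set T) (f g : T -> R) x :
  open U -> (forall y, U y -> f y = g y) -> U x ->
  {for x, continuous f} -> {for x, continuous g}.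
Proof.
move=> oU fg Ux; rewrite /prop_for /continuous_at -(fg _ Ux) => cf.
by apply: cvg_trans cf; apply: near_eq_cvg; apply: near_eq_on Ux.
Qed.

Lemma eq_Ck_on k U f g : open U -> (forall x, U x -> f x = g x) ->
  Ck_on k U f -> Ck_on k U g.
Proof.
move=> oU; elim: k f g => [|k IHk] f g fg [cf df]; split=> //.
- by move=> x Ux; exact: eq_continuous_on oU fg Ux (cf _ Ux).
- by move=> x Ux; exact: eq_continuous_on oU fg Ux (cf _ Ux).
move=> i; have [di Ci] := df i; split=> [x Ux|].
  exact: near_eq_derivable (near_eq_on oU fg Ux) (di _ Ux).
by apply: IHk Ci => x Ux; apply: near_eq_derive; exact: near_eq_on Ux.
Qed.

Lemma Ck_onW k U f : Ck_on k.+1 U f -> Ck_on k U f.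
Proof.
elim: k f => [|k IHk] f /=; first by case.
case=> cf df; split=> // i; have [di Ci] := df i.
by split=> //; exact: IHk.
Qed.

Lemma Ck_on_cst k U (a : R) : open U -> Ck_on k U (cst a).
Proof.
move=> oU; elim: k a => [|k IHk] a; split=> //.
- by move=> x _; exact: cst_continuous.
- by move=> x _; exact: cst_continuous.
move=> i; split=> [x _|]; first exact: derivable_cst.
by apply: eq_Ck_on (IHk 0) => // x _; rewrite derive_cst.
Qed.

Lemma Ck_onD k U f g : open U -> Ck_on k U f -> Ck_on k U g ->
  Ck_on k U (f + g).
Proof.
move=> oU; elim: k f g => [|k IHk] f g [cf df] [cg dg]; split=> //.
- by move=> x Ux; apply: continuousD; [exact: cf|exact: cg].
- by move=> x Ux; apply: continuousD; [exact: cf|exact: cg].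
move=> i; have [[dfi Cfi] [dgi Cgi]] := (df i, dg i); split=> [x Ux|].
  by apply: derivableD; [exact: dfi|exact: dgi].
apply: eq_Ck_on (IHk _ _ Cfi Cgi) => // x Ux.
by rewrite deriveD//; [exact: dfi|exact: dgi].
Qed.

Lemma Ck_onM k U f g : open U -> Ck_on k U f -> Ck_on k U g ->
  Ck_on k U (f * g).
Proof.
move=> oU; elim: k f g => [|k IHk] f g Cf Cg.
all: have [[cf df] [cg dg]] := (Cf, Cg); split=> //.
- by move=> x Ux; apply: continuousM; [exact: cf|exact: cg].
- by move=> x Ux; apply: continuousM; [exact: cf|exact: cg].
move=> i; have [[dfi Cfi] [dgi Cgi]] := (df i, dg i); split=> [x Ux|].
  by apply: derivableM; [exact: dfi|exact: dgi].
have := Ck_onD oU (IHk _ _ (Ck_onW Cf) Cgi) (IHk _ _ (Ck_onW Cg) Cfi).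
apply: eq_Ck_on => // x Ux.
by rewrite deriveM//; [exact: dfi|exact: dgi].
Qed.

End SmoothOn.

Section SmoothFunctions.
Context (R : realType) (n : nat) (M : smoothManifold R n).

Definition smooth_pred : {pred (M -> R)} := mem [set f : M -> R | smooth f].

Record smoothFun := SmoothFun {
  smooth_val :> M -> R; smooth_valP : smooth_val \in smooth_pred }.

HB.instance Definition _ := [isSub for smooth_val].
HB.instance Definition _ := [Choice of smoothFun by <:].

Lemma smooth_cst (a : R) : cst a \in smooth_pred.
Proof. by apply/mem_set => c _ k; apply: Ck_on_cst; exact: ccod_open. Qed.

Lemma smoothD (f g : M -> R) : f \in smooth_pred -> g \in smooth_pred ->
  f + g \in smooth_pred.
Proof.
move=> /set_mem sf /set_mem sg; apply/mem_set => c ac k.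
by apply: Ck_onD; [exact: ccod_open|exact: sf|exact: sg].
Qed.

Lemma smoothM (f g : M -> R) : f \in smooth_pred -> g \in smooth_pred ->
  f * g \in smooth_pred.
Proof.
move=> /set_mem sf /set_mem sg; apply/mem_set => c ac k.
by apply: Ck_onM; [exact: ccod_open|exact: sf|exact: sg].
Qed.

Lemma smooth_subring_closed : subring_closed smooth_pred.
Proof.
have sN g : g \in smooth_pred -> - g \in smooth_pred.
  move=> sg; have -> : - g = cst (-1) * g.
    by apply/funext => x; rewrite /GRing.mul /= mulN1r.
  by apply: smoothM => //; exact: smooth_cst.
split=> [|f g sf sg|f g sf sg]; first exact: smooth_cst.
- by apply: smoothD => //; exact: sN.
- exact: smoothM.
Qed.

HB.instance Definition _ :=
  GRing.isSubringClosed.Build (M -> R) smooth_pred smooth_subring_closed.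

HB.instance Definition _ := 
  GRing.SubChoice_isSubComPzRing.Build (M -> R) smooth_pred smoothFun
    smooth_subring_closed.

Lemma smooth_scaler_closed : GRing.scaler_closed smooth_pred.
Proof.
move=> a f sf; have -> : a *: f = cst a * f by apply/funext.
by apply: smoothM => //; exact: smooth_cst.
Qed.

HB.instance Definition _ :=
  GRing.isScaleClosed.Build R (M -> R) smooth_pred smooth_scaler_closed.

HB.instance Definition _ := [SubZmodule_isSubLmodule of smoothFun by <:].

End SmoothFunctions.

Section VectorFields.
Context (R : realType) (n : nat) (M : smoothManifold R n).
Local Notation A := (smoothFun M).
Implicit Types (f h : A) (a : R).

(* Smooth vector fields are the derivations of the algebra of smooth functions
   on M; they form a module over it. *)
Definition derivation (X : A -> A) : Prop :=
  (forall a f h, X (a *: f + h) = a *: X f + X h) /\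
  (forall f h, X (f * h) = X f * h + f * X h).

Definition derivation_pred : {pred (A -> A^o)} :=
  mem [set X : A -> A^o | derivation X].

Record vectorField := VectorField {
  derivation_val :> A -> A^o;
  derivation_valP : derivation_val \in derivation_pred }.

HB.instance Definition _ := [isSub for derivation_val].
HB.instance Definition _ := [Choice of vectorField by <:].

Lemma smooth_scalerAl a f h : a *: (f * h) = (a *: f) * h.
Proof. by apply/val_inj/funext => p; exact: mulrA. Qed.

Lemma smooth_scalerAr a f h : a *: (f * h) = f * (a *: h).
Proof. by rewrite mulrC smooth_scalerAl mulrC. Qed.

Lemma derivation_submod_closed : GRing.subsemimod_closed derivation_pred.
Proof.
split; first split.
- apply/mem_set; split=> [a f h|f h].
    by have E k : (0 : A -> A^o) k = 0 by []; rewrite !E scaler0 addr0.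
  by have E k : (0 : A -> A^o) k = 0 by []; rewrite !E mul0r mulr0 addr0.
- move=> X Y /set_mem[Xl XM] /set_mem[Yl YM]; apply/mem_set.
  have E k : (X + Y) k = X k + Y k by [].
  split=> [a f h|f h]; rewrite !E.
    by rewrite Xl Yl scalerDr addrACA.
  by rewrite XM YM mulrDl mulrDr addrACA.
move=> f X /set_mem[Xl XM]; apply/mem_set.
have E k : (f *: X) k = f * X k by [].
split=> [a h k|h k]; rewrite !E.
  by rewrite Xl mulrDr -smooth_scalerAr.
by rewrite XM mulrDr mulrA [f * (h * _)]mulrCA.
Qed.

HB.instance Definition _ :=
  GRing.SubChoice_isSubLmodule.Build A (A -> A^o) derivation_pred vectorField
    derivation_submod_closed.

Lemma lie_bracket_subproof (X Y : vectorField) :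
  ((fun f => (X (Y f) : A) - (Y (X f) : A)) : A -> A^o) \in derivation_pred.
Proof.
have /set_mem[Xl XM] := derivation_valP X.
have /set_mem[Yl YM] := derivation_valP Y.
have XD f h : X (f + h) = X f + X h by have := Xl 1 f h; rewrite !scale1r.
have YD f h : Y (f + h) = Y f + Y h by have := Yl 1 f h; rewrite !scale1r.
apply/mem_set; split=> [a f h|f h].
  by rewrite Yl Xl Xl Yl opprD addrACA; congr (_ + _); rewrite scalerBr.
rewrite YM XD !XM YD !YM mulrBl mulrBr.
have E (a b c d e x : A) : x + a + (b + c) - (d + b + (a + e)) =
    x - d + (c - e).
  rewrite [b + c]addrC [a + e]addrC [x + a + _]addrACA [d + b + _]addrACA.
  by rewrite [b + a]addrC opprD [LHS]addrACA subrr addr0 opprD [LHS]addrACA.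
exact: E.
Qed.

Definition lie_bracket (X Y : vectorField) : vectorField :=
  VectorField (lie_bracket_subproof X Y).

End VectorFields.

Section SemiRiemannian.
Context (R : realType) (n : nat) (M : smoothManifold R n).
Local Notation A := (smoothFun M).
Local Notation VF := (vectorField M).

(* Nondegeneracy is that of each g_p: every tangent vector at p is the value at
   p of a vector field X, and this value vanishes iff X f p = 0 for every f.
   The index of g is locally constant, hence constant when M is connected. *)
Record semiRiemannianMetric := SemiRiemannianMetric {
  metric :> VF -> VF -> A;
  metric_sym : forall X Y : VF, metric X Y = metric Y X;
  metric_linear : forall (f : A) (X Y Z : VF),
    metric (f *: X + Y) Z = f * metric X Z + metric Y Z;
  metric_nondegenerate : forall (X : VF) (p : M),
    (forall Y, metric X Y p = 0) -> forall f : A, X f p = 0 }.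

(* R-linearity of nabla in its second argument follows from additivity and the
   Leibniz rule, vector fields killing constant functions. *)
Record is_levi_civita (g : semiRiemannianMetric) (nabla : VF -> VF -> VF) :
    Prop := IsLeviCivita {
  nabla_linear : forall (f : A) (X Y Z : VF),
    nabla (f *: X + Y) Z = f *: nabla X Z + nabla Y Z;
  nabla_additive : forall X Y Z : VF, nabla X (Y + Z) = nabla X Y + nabla X Z;
  nabla_leibniz : forall (X : VF) (f : A) (Y : VF),
    nabla X (f *: Y) = X f *: Y + f *: nabla X Y;
  nabla_torsion_free : forall X Y : VF, nabla X Y - nabla Y X = lie_bracket X Y;
  nabla_metric : forall X Y Z : VF,
    X (g Y Z) = g (nabla X Y) Z + g Y (nabla X Z) }.

Definition tensor2 := VF -> VF -> M -> R.
Definition tensor4 := VF -> VF -> VF -> VF -> M -> R.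

(* For n vector fields on M, an invertible Gram matrix at p means that their
   values at p form a basis of the tangent space at p. Every such basis is the
   value of some vector fields, so that frame_at below is a genuine frame. *)
Definition gram (g : semiRiemannianMetric) (p : M) (E : 'I_n -> VF) : 'M[R]_n :=
  \matrix_(i, j) g (E i) (E j) p.

Definition frame_at (g : semiRiemannianMetric) (p : M) : 'I_n -> VF :=
  xget (fun=> 0) [set E | gram g p E \in unitmx].

(* The g-trace g^{ij} B(E_i, E_j) at p, which does not depend on the frame E. *)
Definition metric_trace (g : semiRiemannianMetric) (B : tensor2) (p : M) : R :=
  let E := frame_at g p in
  \sum_i \sum_j invmx (gram g p E) i j * B (E i) (E j) p.

Definition kulkarni_nomizu (B E : tensor2) : tensor4 := fun X1 X2 X3 X4 p =>
  B X1 X4 p * E X2 X3 p + B X2 X3 p * E X1 X4 p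
  - B X1 X3 p * E X2 X4 p - B X2 X4 p * E X1 X3 p.

Section Curvature.
Context (g : semiRiemannianMetric) (nabla : VF -> VF -> VF).

Definition curvature_operator (X Y Z : VF) : VF :=
  nabla X (nabla Y Z) - nabla Y (nabla X Z) - nabla (lie_bracket X Y) Z.

Definition metric_tensor : tensor2 := fun X Y => g X Y.

Definition riemann : tensor4 := fun X1 X2 X3 X4 =>
  g (curvature_operator X1 X2 X3) X4.

Definition ricci : tensor2 := fun X2 X3 =>
  metric_trace g (fun X1 X4 => riemann X1 X2 X3 X4).

Definition scalar_curvature : M -> R := metric_trace g ricci.

Definition conformal : tensor4 := fun X1 X2 X3 X4 p =>
  riemann X1 X2 X3 X4 p
  - (n%:R - 2)^-1 * kulkarni_nomizu metric_tensor ricci X1 X2 X3 X4 p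
  + scalar_curvature p / (2 * (n%:R - 1) * (n%:R - 2))
    * kulkarni_nomizu metric_tensor metric_tensor X1 X2 X3 X4 p.

Definition concircular : tensor4 := fun X1 X2 X3 X4 p =>
  riemann X1 X2 X3 X4 p
  - scalar_curvature p / (2 * n%:R * (n%:R - 1))
    * kulkarni_nomizu metric_tensor metric_tensor X1 X2 X3 X4 p.

Definition conharmonic : tensor4 := fun X1 X2 X3 X4 p =>
  riemann X1 X2 X3 X4 p
  - (n%:R - 2)^-1 * kulkarni_nomizu metric_tensor ricci X1 X2 X3 X4 p.

Definition projective : tensor4 := fun X1 X2 X3 X4 p =>
  riemann X1 X2 X3 X4 p
  - (n%:R - 1)^-1
    * (ricci X2 X3 p * g X1 X4 p - ricci X1 X3 p * g X2 X4 p).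

(* calD is the (1,3)-tensor g(calD(X, Y) X1, X2) = D(X, Y, X1, X2); it exists
   for smooth D and is unique, g being nondegenerate. *)
Definition metrically_equivalent (D : tensor4) (calD : VF -> VF -> VF -> VF) :=
  forall X Y X1 X2 p, g (calD X Y X1) X2 p = D X Y X1 X2 p.

(* D . H for the (0,4)-tensor H, with calD metrically equivalent to D. *)
Definition dot (calD : VF -> VF -> VF -> VF) (H : tensor4)
    (X1 X2 X3 X4 X Y : VF) (p : M) : R :=
  - H (calD X Y X1) X2 X3 X4 p - H X1 (calD X Y X2) X3 X4 p
  - H X1 X2 (calD X Y X3) X4 p - H X1 X2 X3 (calD X Y X4) p.

Definition walker_identity (D1 D2 : tensor4) : Prop :=
  forall calD1, metrically_equivalent D1 calD1 ->
  forall (X1 X2 X3 X4 X5 X6 : VF) (p : M),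
    dot calD1 D2 X1 X2 X3 X4 X5 X6 p + dot calD1 D2 X3 X4 X5 X6 X1 X2 p
    + dot calD1 D2 X5 X6 X1 X2 X3 X4 p = 0.

End Curvature.
End SemiRiemannian.

(* Main.v *)
(** Call a (0,4)-tensor D curvature-like if it is skew in its first and in its
    last two arguments and symmetric under exchange of these pairs. Each term of
    D . D is then g(calD(..).., calD(..)..), and in the cyclic sum these cancel
    in pairs. Since D . (g /\ g) = 0 by skewness, D . (D + c g /\ g) = D . D,
    which covers the pairs (R,W), (W,R), (K,C) and (C,K). For (P,R), the term
    of P . R in the Ricci tensor S cancels in the cyclic sum because S is
    symmetric and R is curvature-like. *)
Require Import Defs.
From mathcomp Require Import all_boot all_order all_algebra.
From mathcomp Require Import all_classical all_reals all_analysis.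
From mathcomp Require Import ring lra.

Set Implicit Arguments.
Unset Strict Implicit.
Unset Printing Implicit Defensive.
Import GRing.Theory.
Local Open Scope classical_set_scope.
Local Open Scope ring_scope.

(** * Lie bracket of derivations and the Jacobi identity *)

Section LieBracket.
Context (R : realType) (n : nat) (M : smoothManifold R n).
Local Notation A := (smoothFun M).
Local Notation VF := (vectorField M).
Implicit Types (X Y Z : VF) (f : A).

Lemma vectorField_eqP X Y : (forall f, X f = Y f :> A) -> X = Y.
Proof. by move=> XY; apply/val_inj/funext. Qed.

Lemma vectorFieldD_app X f h : X (f + h) = X f + X h :> A.
Proof.
have /set_mem[Xl _] := derivation_valP X.
by have := Xl 1 f h; rewrite !scale1r.
Qed.

Lemma vectorFieldB_app X f h : X (f - h) = X f - X h :> A.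
Proof.
by apply/eqP; rewrite eq_sym subr_eq -vectorFieldD_app addrNK.
Qed.

Lemma lie_bracketC X Y : lie_bracket X Y = - lie_bracket Y X.
Proof.
apply: vectorField_eqP => f.
change ((X (Y f) : A) - Y (X f) = - ((Y (X f) : A) - X (Y f))).
by rewrite opprB.
Qed.

(** On a function, each of the six orders of composing X, Y and Z occurs twice, with opposite
    signs. *)
Lemma jacobi X Y Z :
  lie_bracket X (lie_bracket Y Z) + lie_bracket Y (lie_bracket Z X)
  + lie_bracket Z (lie_bracket X Y) = 0.
Proof.
apply: vectorField_eqP => f.
change (
  ((X ((Y (Z f) : A) - Z (Y f)) : A) - ((Y (Z (X f)) : A) - Z (Y (X f))))
  + ((Y ((Z (X f) : A) - X (Z f)) : A) - ((Z (X (Y f)) : A) - X (Z (Y f))))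
  + ((Z ((X (Y f) : A) - Y (X f)) : A) - ((X (Y (Z f)) : A) - Y (X (Z f))))
  = 0).
rewrite !vectorFieldB_app.
have alternating (a b c d e h : A) :
    (a - b - (c - d)) + (c - e - (h - b)) + (h - d - (a - e)) = 0.
  apply/val_inj/funext => p.
  change (a p - b p - (c p - d p) + (c p - e p - (h p - b p))
    + (h p - d p - (a p - e p)) = 0).
  ring.
exact: alternating.
Qed.

End LieBracket.

(** * Cyclic sums for curvature-like tensors *)

Section CurvatureLike.
Context (R : realType) (n : nat) (M : smoothManifold R n).
Local Notation A := (smoothFun M).
Local Notation VF := (vectorField M).
Implicit Types (g : semiRiemannianMetric M) (D E : tensor4 M) (B : tensor2 M).
Implicit Types (X Y Z : VF) (p : M).

Record curvature_like D : Prop := CurvatureLike {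
  curv_skewl : forall X1 X2 X3 X4 p, D X1 X2 X3 X4 p = - D X2 X1 X3 X4 p;
  curv_skewr : forall X1 X2 X3 X4 p, D X1 X2 X3 X4 p = - D X1 X2 X4 X3 p;
  curv_pair : forall X1 X2 X3 X4 p, D X1 X2 X3 X4 p = D X3 X4 X1 X2 p }.

Lemma kulkarni_nomizu_curvature_like (B E : tensor2 M) :
  (forall X Y p, B X Y p = B Y X p) -> (forall X Y p, E X Y p = E Y X p) ->
  curvature_like (kulkarni_nomizu B E).
Proof.
move=> BC EC; split=> X1 X2 X3 X4 p; rewrite /kulkarni_nomizu.
- ring.
- ring.
by rewrite (BC X3 X2) (BC X4 X1) (BC X3 X1) (BC X4 X2) (EC X3 X2) (EC X4 X1)
   (EC X3 X1) (EC X4 X2); ring.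
Qed.

Lemma curvature_like_comb D E (c : M -> R) :
  curvature_like D -> curvature_like E ->
  curvature_like (fun X1 X2 X3 X4 p => D X1 X2 X3 X4 p + c p * E X1 X2 X3 X4 p).
Proof.
move=> [Dl Dr Dp] [El Er Ep]; split=> X1 X2 X3 X4 p.
- by rewrite Dl El; ring.
- by rewrite Dr Er; ring.
by rewrite Dp Ep.
Qed.

Lemma curvature_like_ext D E : curvature_like D ->
  (forall X1 X2 X3 X4 p, D X1 X2 X3 X4 p = E X1 X2 X3 X4 p) -> curvature_like E.
Proof.
by move=> [Dl Dr Dp] DE; split=> *;
  rewrite -!DE; [apply: Dl|apply: Dr|apply: Dp].
Qed.

(** Pair symmetry and skewness move the argument hit by [calD] to the last slot of H, where H(U, V,
    Y, Z) is g(calH(U, V) Y, Z). *)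
Lemma dot_curvature_like g H calD calH X1 X2 X3 X4 X5 X6 p :
  curvature_like H -> metrically_equivalent g H calH ->
  dot calD H X1 X2 X3 X4 X5 X6 p =
    g (calH X3 X4 X2) (calD X5 X6 X1) p - g (calH X3 X4 X1) (calD X5 X6 X2) p
    + g (calH X1 X2 X4) (calD X5 X6 X3) p - g (calH X1 X2 X3) (calD X5 X6 X4) p.
Proof.
move=> [_ Hr Hp] eqH; rewrite /dot !eqH.
rewrite (Hp (calD _ _ _)) (Hp _ (calD _ _ _)) (Hr _ _ (calD _ _ X1)).
by rewrite (Hr _ _ (calD _ _ X3)); ring.
Qed.

(** D acts as a derivation, hence on g /\ g only through D . g, and D . g = 0 is skewness of D in
    its last two arguments. *)
Lemma dot_metric_kn g D calD X1 X2 X3 X4 X5 X6 p :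
  (forall Y1 Y2 Y3 Y4 q, D Y1 Y2 Y3 Y4 q = - D Y1 Y2 Y4 Y3 q) ->
  metrically_equivalent g D calD ->
  dot calD (kulkarni_nomizu (metric_tensor g) (metric_tensor g))
    X1 X2 X3 X4 X5 X6 p = 0.
Proof.
move=> Dr eqD; rewrite /dot /kulkarni_nomizu /metric_tensor.
rewrite !(Defs.metric_sym g _ (calD _ _ _)) !eqD.
rewrite (Dr _ _ X4 X1) (Dr _ _ X3 X1) (Dr _ _ X3 X2) (Dr _ _ X4 X2); ring.
Qed.

Lemma walker_identity_metric_kn g D E (c : M -> R) : curvature_like D ->
  (forall X1 X2 X3 X4 p, E X1 X2 X3 X4 p = D X1 X2 X3 X4 p + c p *
    kulkarni_nomizu (metric_tensor g) (metric_tensor g) X1 X2 X3 X4 p) ->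
  walker_identity g D E.
Proof.
move=> cD DE calD eqD X1 X2 X3 X4 X5 X6 p.
have dotE Y1 Y2 Y3 Y4 Y5 Y6 : dot calD E Y1 Y2 Y3 Y4 Y5 Y6 p =
    dot calD D Y1 Y2 Y3 Y4 Y5 Y6 p.
  (* The right-hand side is padded with c times the vanishing D . (g /\ g). *)
  rewrite -[RHS]addr0 -(mulr0 (c p)).
  rewrite -(dot_metric_kn Y1 Y2 Y3 Y4 Y5 Y6 p (curv_skewr cD) eqD).
  by rewrite /dot !DE; ring.
rewrite !dotE !(dot_curvature_like _ _ _ _ _ _ _ _ cD eqD).
(* Once the two factors of each product are put in a fixed order, the twelve terms cancel in
   pairs. *)
rewrite !(Defs.metric_sym g (calD X5 X6 _)).
rewrite !(Defs.metric_sym g (calD X3 X4 _) (calD X1 X2 _)).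
ring.
Qed.

(* The extra term of D1 is the lowering of Z |-> B(X2, Z) X1 - B(X1, Z) X2. *)
Lemma walker_identity_projective g D D1 B calD (a : M -> R) :
  curvature_like D -> metrically_equivalent g D calD ->
  (forall X Y p, B X Y p = B Y X p) ->
  (forall X1 X2 X3 X4 p, D1 X1 X2 X3 X4 p = D X1 X2 X3 X4 p
    - a p * (B X2 X3 p * g X1 X4 p - B X1 X3 p * g X2 X4 p)) ->
  walker_identity g D1 D.
Proof.
move=> cD eqD BC D1E calD1 eqD1 X1 X2 X3 X4 X5 X6 p.
rewrite !(dot_curvature_like _ _ _ _ _ _ _ _ cD eqD).
rewrite !(Defs.metric_sym g _ (calD1 _ _ _)) !eqD1 !D1E.
(* The terms free of B become products g(calD(..).., calD(..)..) again and cancel as for D . D; the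
   others become B(Xi, Xj) D(Xk, Xl, Xr, Xs). *)
rewrite !(Defs.metric_sym g _ (calD _ _ _)) !eqD -!(eqD _ _ _ (calD _ _ _)).
rewrite !(Defs.metric_sym g (calD X5 X6 _)).
rewrite !(Defs.metric_sym g (calD X3 X4 _) (calD X1 X2 _)).
(* Each term with B has a partner of the same sign with i, j exchanged and r, s exchanged; symmetry
   of B and skewness of D make the two cancel. *)
have Dr := curv_skewr cD.
rewrite !(Dr X3 X4 X5) !(Dr X3 X4 X6) !(Dr X1 X2 X5) !(Dr X1 X2 X6).
rewrite !(Dr X5 X6 X3) !(Dr X5 X6 X4) !(BC X4) !(BC X3) !(BC X5) !(BC X6); ring.
Qed.

End CurvatureLike.

(** * Symmetries of the Riemann, Ricci and derived curvature tensors *)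

Section Riemann.
Context (R : realType) (n : nat) (M : smoothManifold R n).
Local Notation A := (smoothFun M).
Local Notation VF := (vectorField M).
Context (g : semiRiemannianMetric M) (nabla : VF -> VF -> VF).
Context (nabla_lc : is_levi_civita g nabla).
Implicit Types (X Y Z W : VF) (p : M).

Lemma metricDl X Y Z : g (X + Y) Z = g X Z + g Y Z.
Proof. by have := metric_linear g 1 X Y Z; rewrite scale1r mul1r. Qed.

Lemma metric0l Z : g 0 Z = 0.
Proof. by apply: (addrI (g 0 Z)); rewrite -metricDl !addr0. Qed.

Lemma metricNl X Z : g (- X) Z = - g X Z.
Proof. by apply/eqP; rewrite -addr_eq0 -metricDl addNr metric0l. Qed.

Lemma metricBl X Y Z : g (X - Y) Z = g X Z - g Y Z.
Proof. by rewrite metricDl metricNl. Qed.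

Lemma nablaNl X Z : nabla (- X) Z = - nabla X Z.
Proof.
have D U V : nabla (U + V) Z = nabla U Z + nabla V Z.
  by have := nabla_linear nabla_lc 1 U V Z; rewrite !scale1r.
apply/eqP; rewrite -addr_eq0 -D addNr; apply/eqP.
by apply: (addrI (nabla 0 Z)); rewrite -D !addr0.
Qed.

Lemma nablaBr X Y Z : nabla X (Y - Z) = nabla X Y - nabla X Z.
Proof.
apply/eqP; rewrite eq_sym subr_eq -(nabla_additive nabla_lc) addrNK.
by apply/eqP.
Qed.

Lemma curvature_operatorC X Y Z :
  curvature_operator nabla X Y Z = - curvature_operator nabla Y X Z.
Proof.
by rewrite /curvature_operator (lie_bracketC X Y) nablaNl !opprB opprK addrC.
Qed.

(** Vanishing torsion turns each double bracket of the Jacobi identity into three terms in [nabla];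
    the nine terms regroup into the three curvature operators. *)
Lemma first_bianchi X Y Z :
  curvature_operator nabla X Y Z + curvature_operator nabla Y Z X
  + curvature_operator nabla Z X Y = 0.
Proof.
have tf U V W : lie_bracket U (lie_bracket V W) =
    nabla U (nabla V W) - nabla U (nabla W V) - nabla (lie_bracket V W) U.
  rewrite -(nabla_torsion_free nabla_lc U) -(nabla_torsion_free nabla_lc V W).
  by rewrite nablaBr.
rewrite -(jacobi X Y Z) !tf /curvature_operator.
by rewrite [RHS](AC (3*3*3) ((1*5*9)*(4*8*3)*(7*2*6))).
Qed.

Lemma riemann_skewl X Y Z W p :
  riemann g nabla X Y Z W p = - riemann g nabla Y X Z W p.
Proof. by rewrite /riemann curvature_operatorC metricNl. Qed.

(* Both sides of [X, Y] (g Z W) = X (Y (g Z W)) - Y (X (g Z W)) are expanded by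
   compatibility of the connection with the metric. *)
Lemma riemann_skewr X Y Z W p :
  riemann g nabla X Y Z W p = - riemann g nabla X Y W Z p.
Proof.
have gXY (U V : VF) : U (V (g Z W)) = g (nabla U (nabla V Z)) W
    + g (nabla V Z) (nabla U W) + (g (nabla V W) (nabla U Z)
    + g (nabla U (nabla V W)) Z) :> A.
  rewrite (nabla_metric nabla_lc V) vectorFieldD_app !(nabla_metric nabla_lc U).
  by rewrite (Defs.metric_sym g (nabla U Z)) (Defs.metric_sym g Z).
have gbracket : (X (Y (g Z W)) : A) - Y (X (g Z W)) =
    g (nabla (lie_bracket X Y) Z) W + g Z (nabla (lie_bracket X Y) W) :=
  nabla_metric nabla_lc (lie_bracket X Y) Z W.
move: gbracket; rewrite (Defs.metric_sym g Z (nabla _ _)).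
rewrite !gXY /riemann /curvature_operator !metricBl.
rewrite (Defs.metric_sym g (nabla X Z)) (Defs.metric_sym g (nabla Y Z)).
(* Here b and c are the mixed products of first derivatives of Z and W, common to both expansions; l
   and l' come from the bracket. *)
have skew (a a' b c d d' l l' : A) :
    (a + b + (c + d)) - (a' + c + (b + d')) = l + l' ->
    (a - a' - l) p = - (d - d' - l') p.
  move=> /(congr1 (fun h : A => h p)).
  change (a p + b p + (c p + d p) - (a' p + c p + (b p + d' p)) = l p + l' p ->
    a p - a' p - l p = - (d p - d' p - l' p)).
  lra.
exact: skew.
Qed.

Lemma riemann_bianchi X Y Z W p :
  riemann g nabla X Y Z W p + riemann g nabla Y Z X W p
  + riemann g nabla Z X Y W p = 0.
Proof.
change ((g (curvature_operator nabla X Y Z) W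
  + g (curvature_operator nabla Y Z X) W
  + g (curvature_operator nabla Z X Y) W) p = 0).
by rewrite -!metricDl first_bianchi metric0l.
Qed.

(* Sum of the Bianchi identities over the four choices of the last argument. *)
Lemma riemann_pair X Y Z W p :
  riemann g nabla X Y Z W p = riemann g nabla Z W X Y p.
Proof.
have := (riemann_bianchi Y Z X W p, riemann_bianchi Z X W Y p).
have := (riemann_bianchi X W Y Z p, riemann_bianchi W Y Z X p).
(* Up to skewness six components occur, each twice; in the sum four of them cancel, leaving 2 R(X,
   Y, Z, W) - 2 R(Z, W, X, Y) = 0. *)
rewrite !(riemann_skewl Y X) !(riemann_skewl W Z).
rewrite !(riemann_skewr _ _ Y W) !(riemann_skewr _ _ Z Y).
rewrite !(riemann_skewr _ _ X Z) !(riemann_skewr _ _ W Z).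
rewrite !(riemann_skewr _ _ W X) !(riemann_skewr _ _ Y X).
by move=> [b3 b4] [b1 b2]; lra.
Qed.

Lemma riemann_curvature_like : curvature_like (riemann g nabla).
Proof.
split; [exact: riemann_skewl|exact: riemann_skewr|exact: riemann_pair].
Qed.

(** By the symmetries of R, exchanging X and Y amounts to exchanging the two traced arguments, and
    the inverse Gram matrix is symmetric. *)
Lemma ricci_sym X Y p : ricci g nabla X Y p = ricci g nabla Y X p.
Proof.
rewrite /ricci /metric_trace exchange_big /=; apply: eq_bigr => i _.
apply: eq_bigr => j _; set G := gram g p _.
have Gsym : G^T = G by apply/matrixP => k l; rewrite !mxE Defs.metric_sym.
rewrite -{1}Gsym -trmx_inv mxE riemann_pair riemann_skewl riemann_skewr opprK.
by [].
Qed.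

Lemma metric_kn_curvature_like :
  curvature_like (kulkarni_nomizu (metric_tensor g) (metric_tensor g)).
Proof.
by apply: kulkarni_nomizu_curvature_like => X Y p;
  rewrite /metric_tensor Defs.metric_sym.
Qed.

Lemma concircular_curvature_like : curvature_like (concircular g nabla).
Proof.
apply: curvature_like_ext (curvature_like_comb
  (fun p => - (scalar_curvature g nabla p / (2 * n%:R * (n%:R - 1))))
  riemann_curvature_like metric_kn_curvature_like) _ => X1 X2 X3 X4 p.
by rewrite mulNr.
Qed.

Lemma conharmonic_curvature_like : curvature_like (conharmonic g nabla).
Proof.
have cgS : curvature_like (kulkarni_nomizu (metric_tensor g) (ricci g nabla)).
  apply: kulkarni_nomizu_curvature_like => X Y p; last exact: ricci_sym.
  by rewrite /metric_tensor Defs.metric_sym.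
apply: curvature_like_ext (curvature_like_comb (fun=> - (n%:R - 2)^-1)
  riemann_curvature_like cgS) _ => X1 X2 X3 X4 p.
by rewrite mulNr.
Qed.

(** By definition C is K plus a multiple of g /\ g. *)
Lemma conformal_curvature_like : curvature_like (conformal g nabla).
Proof.
exact: (curvature_like_comb
  (fun p => scalar_curvature g nabla p / (2 * (n%:R - 1) * (n%:R - 2)))
  conharmonic_curvature_like metric_kn_curvature_like).
Qed.

End Riemann.

Theorem proposition4p2 (R : realType) (n : nat) (n_ge3 : (3 <= n)%N)
    (M : smoothManifold R n) (M_connected : connected [set: M])
    (g : semiRiemannianMetric M)
    (nabla : vectorField M -> vectorField M -> vectorField M)
    (nabla_lc : is_levi_civita g nabla) :
  let Riem := riemann g nabla in
  let W := concircular g nabla in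
  let P := projective g nabla in
  let C := conformal g nabla in
  let K := conharmonic g nabla in
  [/\ walker_identity g Riem W, walker_identity g W Riem,
      walker_identity g P Riem, walker_identity g C K
    & walker_identity g K C].
Proof.
(* With these functions, W = R - w g /\ g and C = K + c g /\ g. *)
pose w p := scalar_curvature g nabla p / (2 * n%:R * (n%:R - 1)).
pose c p := scalar_curvature g nabla p / (2 * (n%:R - 1) * (n%:R - 2)).
split.
- apply: (walker_identity_metric_kn (c := fun p => - w p)) => [|*].
    exact: riemann_curvature_like.
  by rewrite mulNr.
- apply: (walker_identity_metric_kn (c := w)) => [|*].
    exact: concircular_curvature_like.
  by rewrite subrK.
(* [riemann] is by definition the lowering of [curvature_operator], which therefore serves as its
   (1,3)-tensor. *)
- apply: (walker_identity_projective (calD := curvature_operator nabla)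
    (B := ricci g nabla) (a := fun=> (n%:R - 1)^-1)) => //.
    exact: riemann_curvature_like.
  exact: ricci_sym.
- apply: (walker_identity_metric_kn (c := fun p => - c p)) => [|*].
    exact: conformal_curvature_like.
  by rewrite mulNr addrK.
- apply: (walker_identity_metric_kn (c := c)) => [|*] //.
  exact: conharmonic_curvature_like.
Qed.
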